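(* We have $$\sum_{k=2}^\infty\left\lfloor\frac{k}{2}\right\rfloor\frac{\zeta(k)}{2^k}=\frac{\pi^2+4}{16}$$ and $$\sum_{k=2}^\infty\left\lfloor\frac{k}{2}\right\rfloor\frac{\zeta(k)}{2^{2k}}=\frac14\left(1+\frac{\pi^2}{8}-\frac{\pi}{4}-G\right).$$
   Context: $\lfloor x\rfloor$ denotes the floor function, $\zeta(z)=\sum_{n=1}^\infty n^{-z}$ ($\Re(z)>1$) is the Riemann zeta function, and $G=\sum_{k=0}^\infty\frac{(-1)^k}{(2k+1)^2}$ is the Catalan constant. *)

(* Defs.v *)
From Stdlib Require Import Reals.
From Coquelicot Require Import Coquelicot.
Open Scope R_scope.

Definition Cexp (z : C) : C := (exp (Re z) * cos (Im z), exp (Re z) * sin (Im z)).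

(* n ^ (- z), for a positive integer n. *)
Definition nat_cpow_opp (n : nat) (z : C) : C :=
  Cexp (Cmult (Copp z) (RtoC (ln (INR n)))).

(* The sum of a convergent complex series, taken componentwise; the value has no
   meaning when the series diverges. *)
Definition CSeries (a : nat -> C) : C :=
  (Series (fun n => Re (a n)), Series (fun n => Im (a n))).

(* The Dirichlet series of the Riemann zeta function, meaningful for 1 < Re z
   only; it is not the analytic continuation. *)
Definition zeta (z : C) : C := CSeries (fun n => nat_cpow_opp (S n) z).

Definition catalan_constant : R := Series (fun k => (-1) ^ k / (2 * INR k + 1) ^ 2).

(* sum_{k >= m} a k converges, with sum l. *)
Definition is_Cseries_from (m : nat) (a : nat -> C) (l : C) : Prop :=
  @is_series C_AbsRing C_NormedModule (fun j => a (m + j)%nat) l.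

(* Main.v *)
Require Import Defs.
From Stdlib Require Import Reals Lra Lia.
From Coquelicot Require Import Coquelicot.
Open Scope R_scope.

(** Both sums have the form sum_k floor(k/2) zeta(k) / c^k with c = 2 or c = 4.
    Expanding zeta(k) = sum_n n^(-k) gives a double series of nonnegative terms,
    so the sums may be exchanged ([is_series_swap_nonneg]). For fixed n, with
    y = 1/(cn), the generating function of floor(k/2) ([is_series_half_pow])
    turns the inner sum into y^2 / ((1 - y)^2 (1 + y)), and partial fractions
    ([half_weight_partial_fraction]) rewrite this as
<<
      1/2 * 1/(cn - 1)^2  +  1/4 * (1/(cn - 1) - 1/(cn + 1)).
>>
    For c = 2 the first part runs over the inverse odd squares, with sum PI^2/8,
    and the second telescopes to 1. For c = 4 the first part runs over the
    denominators congruent to 3 modulo 4, with sum (PI^2/8 - G)/2 because G is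
    the alternating version of the series of inverse odd squares, and the second
    is, up to sign and the first term, Leibniz's series for PI/4.

    The value PI^2/8 ([is_series_inv_odd_sqr]) is obtained from the half-angle
    identity 1/sin^2(t/2) + 1/sin^2(PI/2 - t/2) = 4/sin^2(t). Iterated from
    t = PI/4, it evaluates exactly the sum of 1/sin^2 over the odd multiples of
    PI/2^(n+2) below PI/2. Replacing 1/sin^2(x) by 1/x^2 costs at most 1 per
    term, and the squeeze gives the sum of 1/(2k+1)^2. *)

(** * Nonnegative double series *)

Lemma sum_n_nonneg (a : nat -> R) (N : nat) :
  (forall n, 0 <= a n) -> 0 <= sum_n a N.
Proof.
  intros Ha. rewrite <- (Rmult_0_r (INR (S N))), <- sum_n_const.
  now apply sum_n_m_le.
Qed.

Lemma sum_n_le_series (a : nat -> R) (l : R) (N : nat) :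
  (forall n, 0 <= a n) -> is_series a l -> sum_n a N <= l.
Proof.
  intros Ha Hl. apply (is_lim_seq_incr_compare (sum_n a)); [exact Hl|].
  intros n. rewrite sum_Sn; unfold plus; simpl. specialize (Ha (S n)); lra.
Qed.

(** A finite sum of rows may be summed column by column, and each truncated
    column is at most the full column because the entries are nonnegative. *)
Lemma sum_n_row_sums_le (a : nat -> nat -> R) (r s : nat -> R) (l : R) :
  (forall k n, 0 <= a k n) ->
  (forall k, is_series (a k) (r k)) ->
  (forall n, is_series (fun k => a k n) (s n)) ->
  is_series s l ->
  forall K, sum_n r K <= l.
Proof.
  intros Ha Hr Hs Hl K.
  assert (Hrow : is_series (fun n => sum_n (fun k => a k n) K) (sum_n r K)).
  { induction K as [|K IH].
    - rewrite sum_O. eapply is_series_ext; [|apply Hr].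
      intros n; now rewrite sum_O.
    - rewrite sum_Sn. eapply is_series_ext; [|apply (is_series_plus _ _ _ _ IH (Hr (S K)))].
      intros n; now rewrite sum_Sn. }
  assert (Hle : forall n, 0 <= sum_n (fun k => a k n) K <= s n).
  { intros n; split.
    - now apply sum_n_nonneg.
    - now apply (sum_n_le_series (fun k => a k n)). }
  rewrite <- (is_series_unique _ _ Hrow), <- (is_series_unique _ _ Hl).
  apply Series_le; [exact Hle | now exists l].
Qed.

(** Tonelli's theorem for series. The rows converge since each entry is at most
    the sum of its column, and the column sums are summable. *)
Lemma is_series_swap_nonneg (a : nat -> nat -> R) (s : nat -> R) (l : R) :
  (forall k n, 0 <= a k n) ->
  (forall n, is_series (fun k => a k n) (s n)) ->
  is_series s l ->
  is_series (fun k => Series (a k)) l.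
Proof.
  intros Ha Hs Hl.
  assert (Hr : forall k, is_series (a k) (Series (a k))).
  { intros k. apply Series_correct.
    apply (@ex_series_le R_AbsRing R_CompleteNormedModule _ s); [|now exists l].
    intros n. unfold norm; simpl; unfold abs; simpl.
    rewrite Rabs_pos_eq by auto.
    apply Rle_trans with (sum_n (fun j => a j n) k).
    - destruct k; [rewrite sum_O; lra|].
      rewrite sum_Sn; unfold plus; simpl.
      pose proof (sum_n_nonneg (fun j => a j n) k (fun j => Ha j n)); lra.
    - now apply (sum_n_le_series (fun j => a j n)). }
  assert (Hb := sum_n_row_sums_le a _ s l Ha Hr Hs Hl).
  assert (Hincr : forall K, sum_n (fun k => Series (a k)) K
                            <= sum_n (fun k => Series (a k)) (S K)).
  { intros K; rewrite sum_Sn; unfold plus; simpl.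
    assert (0 <= Series (a (S K))); [|lra].
    apply Rle_trans with (sum_n (a (S K)) 0);
      [now apply sum_n_nonneg | now apply sum_n_le_series]. }
  destruct (ex_finite_lim_seq_incr _ l Hincr Hb) as [l' Hl'].
  replace l with l'; [exact Hl'|].
  (* The reverse inequality is the same bound for the transposed family. *)
  apply Rle_antisym.
  - exact (is_lim_seq_le _ _ _ _ Hb Hl' (is_lim_seq_const l)).
  - refine (is_lim_seq_le _ _ (Finite l) (Finite l') _ Hl (is_lim_seq_const l')).
    apply (sum_n_row_sums_le (fun n k => a k n) s (fun k => Series (a k))); auto.
Qed.

(** * Generating function of floor(k/2) *)

Lemma Int_part_half (j : nat) :
  IZR (Int_part (INR j / 2)) = (2 * INR j - 1 + (-1) ^ j) / 4.
Proof.
  destruct (Nat.Even_or_Odd j) as [[m ->]|[m ->]].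
  - rewrite pow_1_even, mult_INR; simpl (INR 2).
    rewrite <- (Int_part_spec _ (Z.of_nat m)); rewrite <- INR_IZR_INZ; lra.
  - rewrite Nat.add_1_r, pow_1_odd, S_INR, mult_INR; simpl (INR 2).
    rewrite <- (Int_part_spec _ (Z.of_nat m)); rewrite <- INR_IZR_INZ; lra.
Qed.

(** Every term of the degree [j] diagonal in the Cauchy square of the geometric
    series is [y ^ j], and there are [j + 1] of them. *)
Lemma is_series_geom_deriv (y : R) :
  0 <= y < 1 -> is_series (fun j => INR (S j) * y ^ j) (/ (1 - y) ^ 2).
Proof.
  intros Hy.
  assert (Hg : is_series (fun j => y ^ j) (/ (1 - y))).
  { apply is_series_geom. rewrite Rabs_pos_eq; lra. }
  assert (Hp : forall n, 0 <= y ^ n) by (intros; apply pow_le; lra).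
  replace (/ (1 - y) ^ 2) with (/ (1 - y) * / (1 - y)) by (field; lra).
  eapply is_series_ext; [|exact (is_series_mult_pos _ _ _ _ Hg Hg Hp Hp)].
  intros n; cbv beta.
  rewrite (sum_eq _ (fun _ => y ^ n)), sum_cte; [apply Rmult_comm|].
  intros i Hi. rewrite <- pow_add; f_equal; lia.
Qed.

(** The generating function of floor(k/2), from the closed form
    floor(k/2) = (2k - 1 + (-1)^k) / 4 and three geometric-type series. *)
Lemma is_series_half_pow (y : R) :
  0 <= y < 1 ->
  is_series (fun j => IZR (Int_part (INR (2 + j) / 2)) * y ^ (2 + j))
            (y ^ 2 / ((1 - y) ^ 2 * (1 + y))).
Proof.
  intros Hy.
  assert (Hg : is_series (fun j => y ^ j) (/ (1 - y))).
  { apply is_series_geom. rewrite Rabs_pos_eq; lra. }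
  assert (Ha : is_series (fun j => (- y) ^ j) (/ (1 - - y))).
  { apply is_series_geom. rewrite Rabs_Ropp, Rabs_pos_eq; lra. }
  (* 4 floor(k/2) = 2 (j+1) + 1 + (-1)^j for k = j + 2. *)
  assert (H := is_series_plus _ _ _ _
    (is_series_scal_l (y ^ 2 / 2) _ _ (is_series_geom_deriv y Hy))
    (is_series_scal_l (y ^ 2 / 4) _ _ (is_series_plus _ _ _ _ Hg Ha))).
  replace (y ^ 2 / ((1 - y) ^ 2 * (1 + y))) with
    (y ^ 2 / 2 * (/ (1 - y) ^ 2) + y ^ 2 / 4 * (/ (1 - y) + / (1 - - y))) by (field; lra).
  eapply is_series_ext; [|exact H].
  intros j; cbv beta. rewrite Int_part_half.
  change (2 + j)%nat with (S (S j)). rewrite !S_INR.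
  unfold plus, scal; simpl; unfold mult; simpl.
  replace ((- y) ^ j) with ((-1) ^ j * y ^ j) by (rewrite <- Rpow_mult_distr; f_equal; ring).
  field.
Qed.

(** * Sums weighted by zeta values *)

(** Expanding zeta(k) and exchanging the sums over [k] and [n] leaves, for each
    [n], the generating function of floor(k/2) at [x / n]. *)
Lemma is_series_half_zeta (x l : R) :
  0 < x < 1 ->
  is_series (fun n => (x / INR (S n)) ^ 2
     / ((1 - x / INR (S n)) ^ 2 * (1 + x / INR (S n)))) l ->
  is_series (fun j => IZR (Int_part (INR (2 + j) / 2)) *
     (Series (fun n => / INR (S n) ^ (2 + j)) * x ^ (2 + j))) l.
Proof.
  intros Hx Hl.
  assert (Hy : forall n, 0 <= x / INR (S n) < 1).
  { intros n. assert (1 <= INR (S n)) by (rewrite S_INR; pose proof (pos_INR n); lra).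
    split.
    - apply Rlt_le, Rdiv_lt_0_compat; lra.
    - apply Rmult_lt_reg_r with (INR (S n)); [lra|].
      unfold Rdiv; rewrite Rmult_assoc, Rinv_l; lra. }
  set (a := fun j n => IZR (Int_part (INR (2 + j) / 2)) * (x / INR (S n)) ^ (2 + j)).
  assert (Ha : forall j n, 0 <= a j n).
  { intros j n. apply Rmult_le_pos; [|apply pow_le, Hy].
    apply IZR_le.
    assert (H : -1 < IZR (Int_part (INR (2 + j) / 2))).
    { pose proof (base_Int_part (INR (2 + j) / 2)).
      pose proof (pos_INR (2 + j)). lra. }
    apply lt_IZR in H; lia. }
  eapply is_series_ext;
    [|exact (is_series_swap_nonneg a _ l Ha (fun n => is_series_half_pow _ (Hy n)) Hl)].
  intros j; unfold a; cbv beta. rewrite Series_scal_l. f_equal.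
  rewrite <- Series_scal_r. apply Series_ext; intros n.
  unfold Rdiv. rewrite Rpow_mult_distr, pow_inv. ring.
Qed.

(** With u = cm - 1 the left-hand side is (u + 1) / (u^2 (u + 2)), whose partial
    fractions have poles at u = 0 and u = -2 only. *)
Lemma half_weight_partial_fraction (c m : R) :
  1 < c * m ->
  (1 / c / m) ^ 2 / ((1 - 1 / c / m) ^ 2 * (1 + 1 / c / m))
  = / 2 * / (c * m - 1) ^ 2 + / 4 * (/ (c * m - 1) - / (c * m + 1)).
Proof.
  intros H.
  assert (c <> 0) by (intros ->; lra). assert (m <> 0) by (intros ->; lra).
  field. repeat split; lra.
Qed.

(** Reduces both evaluations, c = 2 and c = 4, to two classical series. *)
Lemma is_series_half_zeta_inv (c A D : R) :
  1 < c ->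
  is_series (fun n => / (c * INR (S n) - 1) ^ 2) A ->
  is_series (fun n => / (c * INR (S n) - 1) - / (c * INR (S n) + 1)) D ->
  is_series (fun j => IZR (Int_part (INR (2 + j) / 2)) *
     (Series (fun n => / INR (S n) ^ (2 + j)) / c ^ (2 + j))) (/ 2 * A + / 4 * D).
Proof.
  intros Hc HA HD.
  eapply is_series_ext; [|apply (is_series_half_zeta (1 / c))].
  - intros j; cbv beta. unfold Rdiv. now rewrite Rmult_1_l, pow_inv.
  - assert (/ c < 1) by (rewrite <- Rinv_1; apply Rinv_lt_contravar; lra).
    unfold Rdiv; rewrite Rmult_1_l; split; [apply Rinv_0_lt_compat; lra|lra].
  - eapply is_series_ext;
      [|exact (is_series_plus _ _ _ _ (is_series_scal_l (/ 2) _ _ HA)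
                 (is_series_scal_l (/ 4) _ _ HD))].
    intros n; cbv beta. symmetry. apply half_weight_partial_fraction.
    pose proof (pos_INR n). rewrite S_INR. nra.
Qed.

(** * The sum of the inverse odd squares *)

Lemma inv_sin_sqr_bounds (x : R) :
  0 < x < PI / 2 -> / x ^ 2 <= / sin x ^ 2 <= / x ^ 2 + 1.
Proof.
  intros Hx.
  assert (Hs : 0 < sin x) by (apply sin_gt_0; lra).
  assert (Hc : 0 < cos x) by (apply cos_gt_0; lra).
  assert (Hsx := sin_lt_x x (proj1 Hx)).
  (* This is x <= tan x: by the mean value theorem sin x = x cos c with c < x. *)
  assert (Htan : x * cos x <= sin x).
  { destruct (MVT_cor2 sin cos 0 x (proj1 Hx)) as [c [Hc1 Hc2]].
    { intros; apply derivable_pt_lim_sin. }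
    rewrite sin_0 in Hc1.
    assert (cos x < cos c) by (apply cos_decreasing_1; lra).
    nra. }
  split.
  - apply Rinv_le_contravar; nra.
  - assert (H2 := sin2_cos2 x); unfold Rsqr in H2.
    replace (/ sin x ^ 2) with ((cos x / sin x) ^ 2 + 1).
    2: { replace 1 with (sin x ^ 2 / sin x ^ 2) at 1 by (field; lra).
         replace (/ sin x ^ 2) with ((sin x * sin x + cos x * cos x) / sin x ^ 2)
           by (rewrite H2; field; lra).
         field; lra. }
    apply Rplus_le_compat_r. rewrite <- pow_inv. apply pow_incr. split.
    + apply Rlt_le, Rdiv_lt_0_compat; lra.
    + apply Rmult_le_reg_r with (sin x * x); [nra|].
      replace (cos x / sin x * (sin x * x)) with (x * cos x) by (field; lra).
      replace (/ x * (sin x * x)) with (sin x) by (field; lra). lra.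
Qed.

(** The half angle t/2 and its complement have squared sines with sum 1 and
    product (sin t)^2 / 4. *)
Lemma inv_sin_sqr_half (t : R) :
  0 < t < PI / 2 ->
  / sin (t / 2) ^ 2 + / sin (PI / 2 - t / 2) ^ 2 = 4 * / sin t ^ 2.
Proof.
  intros Ht. rewrite sin_shift.
  assert (0 < sin (t / 2)) by (apply sin_gt_0; lra).
  assert (0 < cos (t / 2)) by (apply cos_gt_0; lra).
  assert (H2 := sin2_cos2 (t / 2)); unfold Rsqr in H2.
  replace (sin t) with (2 * sin (t / 2) * cos (t / 2))
    by (rewrite <- sin_2a; f_equal; field).
  replace (/ sin (t / 2) ^ 2 + / cos (t / 2) ^ 2) with
    ((sin (t / 2) * sin (t / 2) + cos (t / 2) * cos (t / 2))
      / (sin (t / 2) ^ 2 * cos (t / 2) ^ 2)) by (field; lra).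
  rewrite H2; field; lra.
Qed.

Lemma sum_n_fold (g : nat -> R) (N : nat) :
  sum_n g (2 * N + 1) = sum_n (fun k => g k + g (2 * N + 1 - k)%nat) N.
Proof.
  (* Peel off one term at each end until the middle block is empty. *)
  assert (H : forall M, (M <= N)%nat ->
    sum_n g (2 * N + 1) =
      sum_n (fun k => g k + g (2 * N + 1 - k)%nat) M + sum_n_m g (S M) (2 * N - M)).
  { induction M as [|M IH]; intros HM.
    - rewrite sum_O. unfold sum_n. rewrite sum_Sn_m by lia.
      replace (2 * N + 1)%nat with (S (2 * N)) by lia.
      rewrite (sum_n_Sm g) by lia. rewrite !Nat.sub_0_r.
      unfold plus; simpl; ring.
    - rewrite (IH ltac:(lia)), sum_Sn, (sum_Sn_m g (S M)) by lia.
      replace (2 * N - M)%nat with (S (2 * N - S M)) by lia.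
      rewrite (sum_n_Sm g) by lia.
      replace (2 * N + 1 - S M)%nat with (S (2 * N - S M)) by lia.
      unfold plus; simpl; ring. }
  rewrite (H N (Nat.le_refl N)), sum_n_m_zero by lia.
  unfold zero; simpl; ring.
Qed.

(** The odd multiples of PI / (4 (N + 1)); those of index [k <= N] are exactly
    the ones below PI / 2. *)
Definition odd_angle (N k : nat) : R := (2 * INR k + 1) * PI / (4 * INR (S N)).

Lemma odd_angle_bounds (N k : nat) : (k <= N)%nat -> 0 < odd_angle N k < PI / 2.
Proof.
  intros Hk. unfold odd_angle. apply le_INR in Hk.
  pose proof PI_RGT_0. pose proof (pos_INR k). rewrite S_INR.
  split.
  - apply Rdiv_lt_0_compat; nra.
  - apply Rmult_lt_reg_r with (4 * (INR N + 1)); [lra|].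
    replace ((2 * INR k + 1) * PI / (4 * (INR N + 1)) * (4 * (INR N + 1)))
      with ((2 * INR k + 1) * PI) by (field; lra).
    nra.
Qed.

Lemma sum_inv_sin_sqr_double (N : nat) :
  sum_n (fun k => / sin (odd_angle (2 * N + 1) k) ^ 2) (2 * N + 1)
  = 4 * sum_n (fun k => / sin (odd_angle N k) ^ 2) N.
Proof.
  (* With t = odd_angle N k, the angles of index k and 2N+1-k in the doubled
     family are t/2 and PI/2 - t/2. *)
  rewrite sum_n_fold, <- (sum_n_mult_l (K := R_Ring) 4).
  apply sum_n_ext_loc; intros k Hk.
  unfold mult; simpl (Ring.mult _ _).
  rewrite <- (inv_sin_sqr_half _ (odd_angle_bounds N k Hk)).
  pose proof (pos_INR N).
  f_equal; do 3 f_equal; unfold odd_angle; rewrite ?minus_INR by lia;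
    rewrite ?S_INR, ?plus_INR, ?mult_INR; simpl (INR 1); simpl (INR 2); field; lra.
Qed.

(** Only powers of two are reached by doubling, starting from the single angle
    PI / 4; a subsequence is all that the monotone limit below needs. *)
Lemma sum_inv_sin_sqr (n : nat) :
  sum_n (fun k => / sin (odd_angle (2 ^ n - 1) k) ^ 2) (2 ^ n - 1) = 2 * (2 ^ n) ^ 2.
Proof.
  induction n as [|n IH].
  - simpl (2 ^ 0 - 1)%nat. rewrite sum_O.
    replace (odd_angle 0 0) with (PI / 4) by (unfold odd_angle; simpl; field).
    rewrite sin_PI4.
    assert (H := sqrt_sqrt 2 ltac:(lra)).
    replace ((1 / sqrt 2) ^ 2) with (/ (sqrt 2 * sqrt 2))
      by (field; intros E; rewrite E in H; lra).
    rewrite H. simpl; field.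
  - replace (2 ^ S n - 1)%nat with (2 * (2 ^ n - 1) + 1)%nat
      by (pose proof (Nat.pow_nonzero 2 n); simpl; lia).
    rewrite sum_inv_sin_sqr_double, IH. simpl; ring.
Qed.

(** The [2 ^ n] comparisons of 1 / sin^2 with 1 / x^2 lose at most 1 each, which
    is negligible against the exact value [2 * (2 ^ n) ^ 2] of the sum of the
    inverse squared sines. *)
Lemma odd_sqr_partial_bounds (n : nat) :
  PI ^ 2 / 8 - PI ^ 2 / 16 * / INR (S n)
  <= sum_n (fun k => / (2 * INR k + 1) ^ 2) (2 ^ n - 1) <= PI ^ 2 / 8.
Proof.
  set (N := (2 ^ n - 1)%nat). set (B := sum_n _ N).
  assert (HN : INR (S N) = 2 ^ n).
  { change 2 with (INR 2). rewrite <- pow_INR. f_equal. unfold N. pose proof (Nat.pow_nonzero 2 n); lia. }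
  assert (HnN : INR (S n) <= 2 ^ n).
  { rewrite <- HN. apply le_INR. unfold N.
    pose proof (Nat.pow_gt_lin_r 2 n); lia. }
  assert (Hn : 0 < INR (S n)) by (apply lt_0_INR; lia).
  pose proof PI_RGT_0 as HPI.
  assert (HA := sum_inv_sin_sqr n). fold N in HA.
  (* B is, up to scaling, the sum of the inverse squares of the angles. *)
  assert (HB : sum_n (fun k => / odd_angle N k ^ 2) N = 16 * (2 ^ n) ^ 2 / PI ^ 2 * B).
  { unfold B. rewrite <- (sum_n_mult_l (K := R_Ring)). apply sum_n_ext; intros k.
    unfold mult, odd_angle; simpl (Ring.mult _ _). rewrite HN.
    pose proof (pos_INR k). simpl. field. lra. }
  assert (Hb : forall k, (k <= N)%nat ->
    / odd_angle N k ^ 2 <= / sin (odd_angle N k) ^ 2 <= / odd_angle N k ^ 2 + 1)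
    by (intros k Hk; apply inv_sin_sqr_bounds, odd_angle_bounds, Hk).
  assert (H1 : 16 * (2 ^ n) ^ 2 / PI ^ 2 * B <= 2 * (2 ^ n) ^ 2).
  { rewrite <- HA, <- HB, !sum_n_Reals. apply sum_Rle. intros k Hk; apply Hb, Hk. }
  assert (H2 : 2 * (2 ^ n) ^ 2 <= 16 * (2 ^ n) ^ 2 / PI ^ 2 * B + 2 ^ n).
  { apply Rle_trans with (16 * (2 ^ n) ^ 2 / PI ^ 2 * B + INR (S N)); [|lra].
    rewrite <- HA, <- HB, <- (Rmult_1_r (INR (S N))), <- sum_n_const.
    rewrite <- (sum_n_plus (G := R_AbelianMonoid)), !sum_n_Reals. apply sum_Rle.
    intros k Hk; apply Hb, Hk. }
  set (M := 2 ^ n) in *.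
  assert (HM : 0 < 16 * M ^ 2 / PI ^ 2) by (apply Rdiv_lt_0_compat; nra).
  split.
  - apply Rle_trans with (PI ^ 2 / 8 - PI ^ 2 / 16 * / M).
    + assert (/ M <= / INR (S n)) by (apply Rinv_le_contravar; lra). nra.
    + apply Rmult_le_reg_l with (1 := HM).
      replace (16 * M ^ 2 / PI ^ 2 * (PI ^ 2 / 8 - PI ^ 2 / 16 * / M))
        with (2 * M ^ 2 - M) by (field; lra).
      lra.
  - apply Rmult_le_reg_l with (1 := HM).
    replace (16 * M ^ 2 / PI ^ 2 * (PI ^ 2 / 8)) with (2 * M ^ 2) by (field; lra).
    lra.
Qed.

(** The odd part of the Basel problem: the partial sums increase, so their limit
    is that of the subsequence squeezed by [odd_sqr_partial_bounds]. *)
Lemma is_series_inv_odd_sqr :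
  is_series (fun k => / (2 * INR k + 1) ^ 2) (PI ^ 2 / 8).
Proof.
  set (B := sum_n (fun k => / (2 * INR k + 1) ^ 2)).
  assert (Hincr : forall n, B n <= B (S n)).
  { intros n. unfold B. rewrite sum_Sn; unfold plus; simpl (AbelianMonoid.plus _ _).
    pose proof (pos_INR (S n)).
    assert (0 < / (2 * INR (S n) + 1) ^ 2); [|lra].
    apply Rinv_0_lt_compat, pow_lt; lra. }
  assert (Hle : forall n, B n <= B (2 ^ n - 1)%nat).
  { intros n. apply Rge_le, growing_prop; [exact Hincr|].
    pose proof (Nat.pow_gt_lin_r 2 n); lia. }
  destruct (ex_finite_lim_seq_incr B (PI ^ 2 / 8) Hincr) as [l Hl].
  { intros n. eapply Rle_trans; [apply Hle|apply odd_sqr_partial_bounds]. }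
  replace (PI ^ 2 / 8) with l; [exact Hl|].
  assert (Hsub : is_lim_seq (fun n => B (2 ^ n - 1)%nat) l).
  { apply is_lim_seq_subseq; [|exact Hl].
    apply eventually_subseq; intros n. pose proof (Nat.pow_nonzero 2 n); simpl; lia. }
  assert (Hinv : is_lim_seq (fun n => PI ^ 2 / 8 - PI ^ 2 / 16 * / INR (S n)) (PI ^ 2 / 8)).
  { replace (Finite (PI ^ 2 / 8)) with (Finite (PI ^ 2 / 8 - PI ^ 2 / 16 * 0))
      by (f_equal; ring).
    apply is_lim_seq_minus'; [apply is_lim_seq_const|].
    apply is_lim_seq_mult'; [apply is_lim_seq_const|].
    apply (is_lim_seq_incr_1 (fun n => / INR n)).
    apply (is_lim_seq_inv _ p_infty); [apply is_lim_seq_INR|discriminate]. }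
  apply Rle_antisym.
  - exact (is_lim_seq_le _ _ _ _ (fun n => proj2 (odd_sqr_partial_bounds n)) Hsub
             (is_lim_seq_const _)).
  - exact (is_lim_seq_le _ _ _ _ (fun n => proj1 (odd_sqr_partial_bounds n)) Hinv Hsub).
Qed.

(** * The four classical series *)

(** The partial sums of the paired series are a subsequence of those of [a],
    so conditional convergence is enough. *)
Lemma is_series_pair (a : nat -> R) (l : R) :
  is_series a l ->
  is_series (fun m => a (2 * m)%nat + a (2 * m + 1)%nat) l.
Proof.
  intros Ha.
  change (is_lim_seq (sum_n (fun m => a (2 * m)%nat + a (2 * m + 1)%nat)) l).
  apply (is_lim_seq_ext (fun m => sum_n a (2 * m + 1))).
  - induction n as [|n IH].
    + change (2 * 0 + 1)%nat with 1%nat. now rewrite sum_Sn, !sum_O.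
    + rewrite (sum_Sn _ n), <- IH.
      replace (2 * S n + 1)%nat with (S (S (2 * n + 1))) by lia.
      rewrite (sum_Sn a (S (2 * n + 1))), (sum_Sn a (2 * n + 1)).
      replace (2 * S n)%nat with (S (2 * n + 1)) by lia.
      unfold plus; simpl; ring.
  - apply (is_lim_seq_subseq (sum_n a)); [|exact Ha].
    apply eventually_subseq; intros n; lia.
Qed.

Lemma is_series_leibniz : is_series (fun k => (-1) ^ k / (2 * INR k + 1)) (PI / 4).
Proof.
  apply is_series_Reals. intros eps Heps.
  destruct exist_PI as [l Hl] eqn:E.
  replace (PI / 4) with l.
  - destruct (Hl eps Heps) as [N HN]. exists N; intros n Hn.
    rewrite (sum_eq _ (tg_alt PI_tg)); [exact (HN n Hn)|].
    intros i _. unfold tg_alt, PI_tg. rewrite plus_INR, mult_INR. reflexivity.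
  - rewrite <- Alt_PI_eq. unfold Alt_PI. rewrite E. field.
Qed.

Lemma is_series_catalan :
  is_series (fun k => (-1) ^ k / (2 * INR k + 1) ^ 2) catalan_constant.
Proof.
  apply Series_correct.
  apply (@ex_series_le R_AbsRing R_CompleteNormedModule _ (fun k => / (2 * INR k + 1) ^ 2));
    [|eexists; apply is_series_inv_odd_sqr].
  intros k. unfold norm; simpl; unfold abs; simpl.
  assert (0 < 2 * INR k + 1) by (pose proof (pos_INR k); lra).
  assert (Hp : 0 < (2 * INR k + 1) * ((2 * INR k + 1) * 1)) by nra.
  unfold Rdiv; rewrite Rabs_mult, pow_1_abs, Rabs_inv, Rabs_pos_eq; lra.
Qed.

Lemma is_series_inv_2n_pred_sqr :
  is_series (fun n => / (2 * INR (S n) - 1) ^ 2) (PI ^ 2 / 8).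
Proof.
  eapply is_series_ext; [|exact is_series_inv_odd_sqr].
  intros n; cbv beta. rewrite S_INR. do 2 f_equal. ring.
Qed.

Lemma is_series_odd_telescope :
  is_series (fun n => / (2 * INR (S n) - 1) - / (2 * INR (S n) + 1)) 1.
Proof.
  change (is_lim_seq (sum_n (fun n => / (2 * INR (S n) - 1) - / (2 * INR (S n) + 1))) 1).
  apply (is_lim_seq_ext (fun N => 1 - / (2 * INR (S N) + 1))).
  - induction n as [|n IH].
    + rewrite sum_O. simpl; field.
    + rewrite sum_Sn, <- IH. unfold plus; simpl (AbelianMonoid.plus _ _).
      pose proof (pos_INR n). rewrite !S_INR. field. lra.
  - replace (Finite 1) with (Finite (1 - 0)) by (f_equal; ring).
    apply is_lim_seq_minus'; [apply is_lim_seq_const|].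
    apply (is_lim_seq_inv _ p_infty); [|discriminate].
    apply (is_lim_seq_incr_1 (fun n => 2 * INR n + 1)).
    apply (is_lim_seq_le_p_loc INR); [|apply is_lim_seq_INR].
    exists 0%nat; intros n _. pose proof (pos_INR n); lra.
Qed.

(** Half the difference between the series of 1/(2k+1)^2 and Catalan's series
    keeps only the odd [k], that is the denominators congruent to 3 modulo 4. *)
Lemma is_series_inv_4n_pred_sqr :
  is_series (fun n => / (4 * INR (S n) - 1) ^ 2) ((PI ^ 2 / 8 - catalan_constant) / 2).
Proof.
  assert (H : is_series
      (fun k => / 2 * (/ (2 * INR k + 1) ^ 2 - (-1) ^ k / (2 * INR k + 1) ^ 2))
      (/ 2 * (PI ^ 2 / 8 - catalan_constant))).
  { exact (is_series_scal_l (/ 2) _ _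
             (is_series_minus _ _ _ _ is_series_inv_odd_sqr is_series_catalan)). }
  replace ((PI ^ 2 / 8 - catalan_constant) / 2)
    with (/ 2 * (PI ^ 2 / 8 - catalan_constant)) by field.
  eapply is_series_ext; [|exact (is_series_pair _ _ H)].
  intros n; cbv beta. simpl NormedModule.sort.
  rewrite (pow_1_even n), Nat.add_1_r, pow_1_odd, !S_INR, mult_INR; simpl (INR 2).
  pose proof (pos_INR n). field; lra.
Qed.

(** Leibniz's series without its first term, negated and grouped in pairs. *)
Lemma is_series_leibniz_tail :
  is_series (fun n => / (4 * INR (S n) - 1) - / (4 * INR (S n) + 1)) (1 - PI / 4).
Proof.
  assert (Htail : is_series (fun k => (-1) ^ S k / (2 * INR (S k) + 1)) (PI / 4 - 1)).
  { apply (is_series_incr_1 (fun k => (-1) ^ k / (2 * INR k + 1))).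
    replace (plus _ _) with (PI / 4); [exact is_series_leibniz|].
    unfold plus; simpl; field. }
  assert (H := is_series_opp _ _ (is_series_pair _ _ Htail)).
  replace (1 - PI / 4) with (opp (PI / 4 - 1)) by (unfold opp; simpl; ring).
  eapply is_series_ext; [|exact H].
  intros n; cbv beta. unfold opp; simpl (AbelianGroup.opp _ _). simpl NormedModule.sort.
  rewrite (Nat.add_1_r (2 * n)), pow_1_odd.
  replace (S (S (2 * n))) with (2 * S n)%nat by lia.
  rewrite pow_1_even, !mult_INR, !S_INR, !mult_INR; simpl (INR 0); simpl (INR 2).
  pose proof (pos_INR n). field; lra.
Qed.

(** * Passage to complex series *)

Lemma is_Cseries_RtoC (a : nat -> R) (l : R) :
  is_series a l ->
  @is_series C_AbsRing C_NormedModule (fun n => RtoC (a n)) (RtoC l).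
Proof.
  intros Ha.
  assert (Hsum : forall N, @sum_n C_AbelianMonoid (fun n => RtoC (a n)) N = RtoC (sum_n a N)).
  { induction N as [|N IH].
    - now rewrite !sum_O.
    - rewrite !sum_Sn, IH. now rewrite <- RtoC_plus. }
  intros P [eps HP].
  destruct (Ha (ball l eps) (locally_ball l eps)) as [N HN].
  exists N; intros n Hn. apply HP.
  change (ball (RtoC l) eps (@sum_n C_AbelianMonoid (fun k => RtoC (a k)) n)).
  rewrite Hsum.
  split; simpl; [exact (HN n Hn) | apply ball_center].
Qed.

Lemma is_Cseries_from_real (a : nat -> C) (r : nat -> R) (l : R) :
  (forall j, a (2 + j)%nat = RtoC (r j)) -> is_series r l -> is_Cseries_from 2 a (RtoC l).
Proof.
  intros Ha Hr. unfold is_Cseries_from.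
  eapply is_series_ext; [|apply is_Cseries_RtoC, Hr].
  intros j; symmetry; apply Ha.
Qed.

Lemma nat_cpow_opp_INR (n k : nat) :
  nat_cpow_opp (S n) (RtoC (INR k)) = RtoC (/ INR (S n) ^ k).
Proof.
  assert (Hn : 0 < INR (S n)) by (apply lt_0_INR; lia).
  unfold nat_cpow_opp, Cexp.
  rewrite <- RtoC_opp, <- RtoC_mult, re_RtoC, im_RtoC, cos_0, sin_0, Rmult_1_r, Rmult_0_r.
  unfold RtoC; f_equal.
  rewrite Ropp_mult_distr_l_reverse, exp_Ropp.
  now rewrite <- (Rpower_pow k (INR (S n)) Hn).
Qed.

Lemma zeta_INR (k : nat) :
  zeta (RtoC (INR k)) = RtoC (Series (fun n => / INR (S n) ^ k)).
Proof.
  unfold zeta, CSeries. apply (f_equal2 (@pair R R)).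
  - apply Series_ext; intros n. now rewrite nat_cpow_opp_INR.
  - rewrite (Series_ext _ (fun n => 0 * 0)).
    + rewrite Series_scal_l; apply Rmult_0_l.
    + intros n. rewrite nat_cpow_opp_INR. simpl; ring.
Qed.

(** * The two evaluations *)

Theorem proposition13 :
  is_Cseries_from 2
    (fun k => (RtoC (IZR (Int_part (INR k / 2))) *
               (zeta (RtoC (INR k)) / RtoC (2 ^ k)))%C)
    (RtoC ((PI ^ 2 + 4) / 16))
  /\
  is_Cseries_from 2
    (fun k => (RtoC (IZR (Int_part (INR k / 2))) *
               (zeta (RtoC (INR k)) / RtoC (2 ^ (2 * k))))%C)
    (RtoC (1 / 4 * (1 + PI ^ 2 / 8 - PI / 4 - catalan_constant))).
Proof.
  split.
  - replace ((PI ^ 2 + 4) / 16) with (/ 2 * (PI ^ 2 / 8) + / 4 * 1) by field.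
    eapply is_Cseries_from_real;
      [|apply (is_series_half_zeta_inv 2);
        [lra|exact is_series_inv_2n_pred_sqr|exact is_series_odd_telescope]].
    intros j. now rewrite zeta_INR, <- RtoC_div, <- RtoC_mult by (apply pow_nonzero; lra).
  - replace (1 / 4 * (1 + PI ^ 2 / 8 - PI / 4 - catalan_constant))
      with (/ 2 * ((PI ^ 2 / 8 - catalan_constant) / 2) + / 4 * (1 - PI / 4)) by field.
    eapply is_Cseries_from_real;
      [|apply (is_series_half_zeta_inv 4);
        [lra|exact is_series_inv_4n_pred_sqr|exact is_series_leibniz_tail]].
    intros j. rewrite zeta_INR, pow_mult. replace (2 ^ 2) with 4 by ring.
    now rewrite <- RtoC_div, <- RtoC_mult by (apply pow_nonzero; lra).
Qed.
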